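(* For every convex body $C \subset \mathbb{H}^d$ we have $$\max \{ \mathrm{width}_H (C) : H \text{ is a supporting hyperplane of } C \} = \mathrm{diam}(C).$$
   Context: $\mathbb{H}^d$ is the $d$-dimensional hyperbolic space, and $|ab|$ is the hyperbolic distance of points $a,b$. A set is convex if with every two points it contains the geodesic segment joining them. A convex body in $\mathbb{H}^d$ is a closed bounded convex set with non-empty interior. A hyperplane $H$ supports a convex body $C$ if $H$ has a common point with $C$ and $H$ is disjoint from the interior of $C$. For non-empty sets $A,B$, $\mathrm{dist}(A,B)$ is the infimum of $|ab|$ over $a\in A$, $b\in B$. Two hyperplanes are ultraparallel if they do not intersect in a real or imaginary point (that is, they meet neither in $\mathbb{H}^d$ nor at infinity). For a hyperplane $H$ supporting a convex body $C$, the width $\mathrm{width}_H(C)$ of $C$ determined by $H$ is the distance $\mathrm{dist}(H,J)$ between $H$ and any farthest (from $H$) hyperplane $J$ among those ultraparallel to $H$ and supporting $C$. The diameter $\mathrm{diam}(A)$ of a set $A\subset\mathbb{H}^d$ is the supremum of the distances between pairs of points of $A$. *)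

(* Defs.v *)
From HB Require Import structures.
From mathcomp Require Import all_boot all_order all_algebra.
From mathcomp Require Import ring lra.
From mathcomp Require Import all_classical all_reals all_analysis.

Set Implicit Arguments.
Unset Strict Implicit.
Unset Printing Implicit Defensive.

Import Order.TTheory GRing.Theory Num.Theory.
Import numFieldNormedType.Exports.

Local Open Scope classical_set_scope.
Local Open Scope ring_scope.

(* Hyperbolic space is the hyperboloid model in R^(d+1): coordinate 0 is the
   timelike one. *)
Section Lorentz.
Context {R : realType} {d : nat}.
Implicit Types (x y z u w : 'rV[R]_d.+1) (a : R).

Definition spatial x y : R :=
  \sum_(i < d) x ord0 (lift ord0 i) * y ord0 (lift ord0 i).

Definition lorentz x y : R := - (x ord0 ord0 * y ord0 ord0) + spatial x y.

Definition hyperboloid : pred 'rV[R]_d.+1 :=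
  [pred x | (lorentz x x == -1) && (0 < x ord0 ord0)].

Lemma spatialC x y : spatial x y = spatial y x.
Proof. by apply: eq_bigr => i _; rewrite mulrC. Qed.

Lemma spatialDl x y z : spatial (x + y) z = spatial x z + spatial y z.
Proof. by rewrite -big_split; apply: eq_bigr => i _; rewrite !mxE mulrDl. Qed.

Lemma spatialZl a x y : spatial (a *: x) y = a * spatial x y.
Proof. by rewrite mulr_sumr; apply: eq_bigr => i _; rewrite !mxE mulrA. Qed.

Lemma spatial_ge0 x : 0 <= spatial x x.
Proof. by apply: sumr_ge0 => i _; rewrite -expr2 sqr_ge0. Qed.

Lemma lorentzC x y : lorentz x y = lorentz y x.
Proof. by rewrite /lorentz spatialC mulrC. Qed.

Lemma lorentzDl x y z : lorentz (x + y) z = lorentz x z + lorentz y z.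
Proof. by rewrite /lorentz spatialDl !mxE; ring. Qed.

Lemma lorentzZl a x y : lorentz (a *: x) y = a * lorentz x y.
Proof. by rewrite /lorentz spatialZl !mxE; ring. Qed.

Lemma lorentzDr x y z : lorentz z (x + y) = lorentz z x + lorentz z y.
Proof. by rewrite lorentzC lorentzDl !(lorentzC z). Qed.

Lemma lorentzZr a x y : lorentz y (a *: x) = a * lorentz y x.
Proof. by rewrite lorentzC lorentzZl lorentzC. Qed.

Lemma discr_le (A B D : R) :
  (forall s t, 0 <= s ^+ 2 * A + 2 * s * t * B + t ^+ 2 * D) -> B ^+ 2 <= A * D.
Proof.
move=> H.
have A0 : 0 <= A by have := H 1 0; lra.
have D0 : 0 <= D by have := H 0 1; lra.
have [D1|D1] := eqVneq D 0.
  have [A1|A1] := eqVneq A 0.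
    have := H 1 (- B); rewrite A1 D1; nra.
  have Ap : 0 < A by rewrite lt0r A1.
  have : 0 <= A * (A * D - B ^+ 2) by have := H (- B) A; nra.
  by rewrite pmulr_rge0// subr_ge0.
have Dp : 0 < D by rewrite lt0r D1.
have : 0 <= D * (A * D - B ^+ 2) by have := H D (- B); nra.
by rewrite pmulr_rge0// subr_ge0.
Qed.

Lemma spatial_CS x y : spatial x y ^+ 2 <= spatial x x * spatial y y.
Proof.
apply: discr_le => s t; have := spatial_ge0 (s *: x + t *: y).
rewrite spatialDl !spatialZl ![spatial _ (_ + _)]spatialC !spatialDl !spatialZl.
by rewrite (spatialC y x); lra.
Qed.

Lemma hyperboloidP x : hyperboloid x ->
  [/\ lorentz x x = -1, 0 < x ord0 ord0 & spatial x x = x ord0 ord0 ^+ 2 - 1].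
Proof.
move=> /andP[/eqP xx x0]; split=> //.
by move: xx; rewrite /lorentz; lra.
Qed.

Lemma orth_time_le y u : hyperboloid y -> lorentz u y = 0 ->
  u ord0 ord0 ^+ 2 * y ord0 ord0 ^+ 2 <= spatial u u * (y ord0 ord0 ^+ 2 - 1).
Proof.
move=> /hyperboloidP[_ _ sy] uy; have := spatial_CS u y; rewrite sy.
have -> : spatial u y = u ord0 ord0 * y ord0 ord0.
  by move: uy; rewrite /lorentz; lra.
by rewrite exprMn.
Qed.

Lemma orth_ge0 y u : hyperboloid y -> lorentz u y = 0 -> 0 <= lorentz u u.
Proof.
move=> Hy uy; have := orth_time_le Hy uy; have := spatial_ge0 u.
have [_ y0 _] := hyperboloidP Hy; have y20 : 0 < y ord0 ord0 ^+ 2 by rewrite exprn_gt0.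
move=> su h; have : u ord0 ord0 ^+ 2 * y ord0 ord0 ^+ 2 <= spatial u u * y ord0 ord0 ^+ 2 by nra.
by rewrite ler_pM2r// /lorentz expr2; lra.
Qed.

Lemma orth_CS y u w : hyperboloid y -> lorentz u y = 0 -> lorentz w y = 0 ->
  lorentz u w ^+ 2 <= lorentz u u * lorentz w w.
Proof.
move=> Hy uy wy; apply: discr_le => s t.
have : 0 <= lorentz (s *: u + t *: w) (s *: u + t *: w).
  by apply: (orth_ge0 Hy); rewrite lorentzDl !lorentzZl uy wy; ring.
rewrite lorentzDl !lorentzZl !lorentzDr !lorentzZr (lorentzC w u).
lra.
Qed.

Lemma orth_eq0 y u : hyperboloid y -> lorentz u y = 0 -> lorentz u u = 0 ->
  u = 0.
Proof.
move=> Hy uy uu; have h := orth_time_le Hy uy.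
have su : spatial u u = u ord0 ord0 ^+ 2 by move: uu; rewrite /lorentz; lra.
have u0 : u ord0 ord0 = 0 by move: h; rewrite su; nra.
move: su; rewrite u0 expr0n/= => /eqP.
rewrite psumr_eq0; last by move=> i _; rewrite -expr2 sqr_ge0.
move=> /allP us; apply/rowP => i; rewrite mxE.
case: (unliftP ord0 i) => [j ->|->//].
by have := us j; rewrite mem_index_enum => /(_ isT)/=; rewrite mulf_eq0 orbb => /eqP.
Qed.

Lemma hyp_projE x y : hyperboloid x -> hyperboloid y ->
  let u := x + lorentz x y *: y in
  lorentz u y = 0 /\ lorentz u u = lorentz x y ^+ 2 - 1.
Proof.
move=> /hyperboloidP[xx _ _] /hyperboloidP[yy _ _] /=.
rewrite !(lorentzDl, lorentzZl, lorentzDr, lorentzZr) xx yy (lorentzC y x).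
by split; ring.
Qed.

Lemma hyp_ge1 x y : hyperboloid x -> hyperboloid y -> 1 <= - lorentz x y.
Proof.
move=> Hx Hy; have [uy uu] := hyp_projE Hx Hy.
have := orth_ge0 Hy uy; rewrite uu.
have [_ x0 sx] := hyperboloidP Hx; have [_ y0 sy] := hyperboloidP Hy.
have := spatial_CS x y; rewrite sx sy => cs.
have x2 : 0 <= x ord0 ord0 ^+ 2 - 1 by rewrite -sx spatial_ge0.
have y2 : 0 <= y ord0 ord0 ^+ 2 - 1 by rewrite -sy spatial_ge0.
have p : 0 < x ord0 ord0 * y ord0 ord0 by rewrite mulr_gt0.
have sxy : spatial x y < x ord0 ord0 * y ord0 ord0.
  rewrite ltNge; apply/negP => h.
  have : (x ord0 ord0 * y ord0 ord0) ^+ 2 <= spatial x y ^+ 2.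
    by rewrite ler_sqr// nnegrE ltW// (lt_le_trans p).
  rewrite exprMn; nra.
have : lorentz x y < 0 by rewrite /lorentz; lra.
move: (lorentz x y) => b b0 b1; nra.
Qed.

Lemma hyp_eq x y : hyperboloid x -> hyperboloid y -> - lorentz x y = 1 -> x = y.
Proof.
move=> Hx Hy /eqP; rewrite eqr_oppLR => /eqP xy.
have [] := hyp_projE Hx Hy; rewrite xy => uy uu.
have := orth_eq0 Hy uy; rewrite uu sqrrN expr1n subrr => /(_ erefl)/eqP.
by rewrite scaleN1r subr_eq0 => /eqP.
Qed.

End Lorentz.

Definition arcosh {R : realType} (t : R) : R := ln (t + Num.sqrt (t ^+ 2 - 1)).

Lemma arcosh1 {R : realType} : arcosh (1 : R) = 0.
Proof. by rewrite /arcosh expr1n subrr sqrtr0 addr0 ln1. Qed.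

Lemma arcosh_le {R : realType} (s t : R) : 1 <= s -> s <= t ->
  arcosh s <= arcosh t.
Proof.
move=> s1 st; have s2 : s ^+ 2 - 1 <= t ^+ 2 - 1 by nra.
rewrite /arcosh ler_ln ?posrE.
- by rewrite lerD// ler_wsqrtr.
- by rewrite ltr_wpDr ?sqrtr_ge0//; lra.
- by rewrite ltr_wpDr ?sqrtr_ge0//; lra.
Qed.

Lemma arcosh_eq0 {R : realType} (t : R) : 1 <= t -> arcosh t = 0 -> t = 1.
Proof.
move=> t1 /eqP; have h := sqrtr_ge0 (t ^+ 2 - 1).
by rewrite /arcosh ln_eq0 => [/eqP|]; lra.
Qed.

Lemma arcoshD {R : realType} (a b : R) : 1 <= a -> 1 <= b ->
  arcosh (a * b + Num.sqrt ((a ^+ 2 - 1) * (b ^+ 2 - 1))) = arcosh a + arcosh b.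
Proof.
move=> a1 b1.
have a2 : 0 <= a ^+ 2 - 1 by nra.
have b2 : 0 <= b ^+ 2 - 1 by nra.
rewrite sqrtrM// /arcosh.
have sa := sqr_sqrtr a2; have sb := sqr_sqrtr b2.
have sa0 := sqrtr_ge0 (a ^+ 2 - 1); have sb0 := sqrtr_ge0 (b ^+ 2 - 1).
move: (Num.sqrt (a ^+ 2 - 1)) (Num.sqrt (b ^+ 2 - 1)) sa sb sa0 sb0 => p q sp sq p0 q0.
have -> : (a * b + p * q) ^+ 2 - 1 = (a * q + b * p) ^+ 2.
  have -> : (a * q + b * p) ^+ 2
    = a ^+ 2 * q ^+ 2 + b ^+ 2 * p ^+ 2 + 2 * a * b * p * q by ring.
  have -> : (a * b + p * q) ^+ 2
    = a ^+ 2 * b ^+ 2 + p ^+ 2 * q ^+ 2 + 2 * a * b * p * q by ring.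
  by rewrite sp sq; ring.
rewrite sqrtr_sqr ger0_norm; last by nra.
by rewrite -lnM ?posrE; [congr ln; ring|lra|lra].
Qed.

Record hyp (R : realType) (d : nat) :=
  Hyp { hval : 'rV[R]_d.+1 ; hvalP : hyperboloid hval }.

HB.instance Definition _ (R : realType) (d : nat) := [isSub for @hval R d].
HB.instance Definition _ (R : realType) (d : nat) :=
  [Choice of hyp R d by <:].

Section Distance.
Context {R : realType} {d : nat}.
Implicit Types a b c : hyp R d.

Definition hdist a b : R := arcosh (- lorentz (hval a) (hval b)).

Lemma hdistxx a : hdist a a = 0.
Proof. by rewrite /hdist; have [-> _ _] := hyperboloidP (hvalP a); rewrite opprK arcosh1. Qed.

Lemma hdist_eq0 a b : hdist a b = 0 -> a = b.
Proof.
move=> /arcosh_eq0 ab; apply: val_inj; apply: hyp_eq; rewrite ?hvalP//.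
by apply: ab; rewrite hyp_ge1 ?hvalP.
Qed.

Lemma hdistC a b : hdist a b = hdist b a.
Proof. by rewrite /hdist lorentzC. Qed.

Lemma hdist_triangle b a c : hdist a c <= hdist a b + hdist b c.
Proof.
have [Ha Hb Hc] := And3 (hvalP a) (hvalP b) (hvalP c).
have ab1 := hyp_ge1 Ha Hb; have cb1 := hyp_ge1 Hc Hb.
rewrite (hdistC b) -arcoshD//; apply: arcosh_le; first exact: hyp_ge1.
have [uy uu] := hyp_projE Ha Hb; have [wy ww] := hyp_projE Hc Hb.
have := orth_CS Hb uy wy; rewrite uu ww => /ler_wsqrtr; rewrite sqrtr_sqr !sqrrN.
have -> : lorentz (hval a + lorentz (hval a) (hval b) *: hval b)
    (hval c + lorentz (hval c) (hval b) *: hval b)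
  = lorentz (hval a) (hval c)
    + lorentz (hval a) (hval b) * lorentz (hval c) (hval b).
  have [bb _ _] := hyperboloidP Hb.
  rewrite !(lorentzDl, lorentzZl, lorentzDr, lorentzZr) bb.
  by rewrite (lorentzC (hval b) (hval c)); ring.
by rewrite ler_norml => /andP[]; lra.
Qed.

End Distance.

HB.instance Definition _ (R : realType) (d : nat) :=
  isMetric.Build R (hyp R d) (@hdistxx R d) (@hdist_eq0 R d) (@hdistC R d)
    (@hdist_triangle R d).

Section Metric.
Context {R : realType} {M : metricType R}.
Implicit Types (a b : M) (A B C : set M).

(* The image of a geodesic, i.e. of an isometric path from a to b. *)
Definition geodesic_segment a b : set M :=
  [set p | exists g : R -> M, [/\ g 0 = a, g (mdist a b) = b,
     {in `[0, mdist a b] &, forall s t, mdist (g s) (g t) = `|s - t|} &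
     (g @` [set` `[0, mdist a b]]) p]].

Definition geodesically_convex C : Prop :=
  forall a b, C a -> C b -> geodesic_segment a b `<=` C.

Definition metric_bounded C : Prop :=
  exists r : R, forall a b, C a -> C b -> mdist a b <= r.

Definition convex_body C : Prop :=
  [/\ closed C, metric_bounded C, geodesically_convex C & C° !=set0].

Definition diam A : R := sup [set mdist a b | a in A & b in A].

Definition set_dist A B : R := inf [set mdist a b | a in A & b in B].

End Metric.

(* A hyperplane is the trace on the hyperboloid of the Lorentz-orthogonal
   complement of a spacelike vector. *)
Record hyperplane (R : realType) (d : nat) := Hyperplane {
  normal : 'rV[R]_d.+1 ;
  normal_spacelike : 0 < lorentz normal normal }.

Section Width.
Context {R : realType} {d : nat}.
Implicit Types (H J K : hyperplane R d) (C : set (hyp R d)).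

Definition plane H : set (hyp R d) :=
  [set x | lorentz (normal H) (hval x) = 0].

(* The points at infinity of hyperbolic space are the lines spanned by nonzero
   isotropic vectors; the set below consists of the representatives of those
   lying on H. *)
Definition plane_at_infinity H : set 'rV[R]_d.+1 :=
  [set v | [/\ v != 0, lorentz v v = 0 & lorentz (normal H) v = 0]].

Definition ultraparallel H J : Prop :=
  plane H `&` plane J = set0 /\
  plane_at_infinity H `&` plane_at_infinity J = set0.

Definition supports H C : Prop :=
  plane H `&` C !=set0 /\ plane H `&` C° = set0.

Definition farthest_support C H J : Prop :=
  [/\ ultraparallel H J, supports J C &
    forall K, ultraparallel H K -> supports K C ->
      set_dist (plane H) (plane K) <= set_dist (plane H) (plane J)].

(* width_H(C) as a relation: it holds of at most one w, and of none if no
   farthest hyperplane exists. *)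
Definition is_width H C (w : R) : Prop :=
  exists2 J, farthest_support C H J & w = set_dist (plane H) (plane J).

End Width.

(* Main.v *)
Require Import Defs.
From mathcomp Require Import all_boot all_order all_algebra.
From mathcomp Require Import ring lra.
From mathcomp Require Import all_classical all_reals all_analysis.

Import Order.TTheory GRing.Theory Num.Theory.
Import numFieldNormedType.Exports.

Local Open Scope classical_set_scope.
Local Open Scope ring_scope.

(** A width never exceeds the diameter: a supporting hyperplane [H] and a farthest
    one [J] each contain a point of [C], so their distance is at most the distance
    of those two points ([set_dist_supports_le]). The diameter is itself a width.
    Let [a], [b] be the ends of a longest segment in [C]; they exist because [C] is
    compact ([compact_hval]). The hyperplanes through [a] and [b] perpendicular
    to the segment support [C], since [C] lies in the ball around either end that
    passes through the other ([perp_plane_supports]). They are ultraparallel at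
    distance [mdist a b] ([perp_planes]), and by the upper bound no supporting
    hyperplane is farther from the first.

    It remains to see that every supporting hyperplane [H] has a width, that is,
    that the distance to the ultraparallel supporting hyperplanes has a maximum.
    For normals [n] and [m], being ultraparallel means that the Gram determinant
    is negative ([ultraparallelP]), and the hyperbolic cosine of the distance is
    then the absolute value of the Lorentz product of the normalised [n] and [m]
    ([set_dist_planes]). This extends to a continuous function on the compact
    set of all supporting hyperplanes with contact points ([compact_contacts]),
    so it has a maximum there. A maximiser is itself ultraparallel to [H], because
    at least one supporting hyperplane is: the one through a point of [C] farthest
    from [H] and perpendicular to the perpendicular dropped from there
    ([opposite_support]). *)

Set Implicit Arguments.
Unset Strict Implicit.
Unset Printing Implicit Defensive.

(** * Algebra of the Lorentz form *)

Section LorentzAlgebra.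
Context {R : realType} {d : nat}.
Implicit Types (x y u v n m : 'rV[R]_d.+1) (a b p q : hyp R d).

Definition lorentzE :=
  (@lorentzDl R d, @lorentzDr R d, @lorentzZl R d, @lorentzZr R d).

Lemma hyp_self a : lorentz (hval a) (hval a) = -1.
Proof. by have [] := hyperboloidP (hvalP a). Qed.

Lemma lorentz_le_N1 a b : lorentz (hval a) (hval b) <= -1.
Proof. by have := hyp_ge1 (hvalP a) (hvalP b); lra. Qed.

Lemma future_timelike_ray y : lorentz y y < 0 -> 0 < y ord0 ord0 ->
  exists a, hval a = (Num.sqrt (- lorentz y y))^-1 *: y.
Proof.
move=> yy y0; set s := Num.sqrt _.
have s0 : 0 < s by rewrite sqrtr_gt0; lra.
have ss : lorentz y y = - s ^+ 2 by rewrite sqr_sqrtr; lra.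
have H : hyperboloid (s^-1 *: y).
  apply/andP; split; last by rewrite mxE mulr_gt0 ?invr_gt0.
  by rewrite !lorentzE ss; apply/eqP; field; rewrite gt_eqF.
by exists (Hyp H).
Qed.

Lemma timelike_line y : lorentz y y < 0 ->
  exists a (k : R), k != 0 /\ hval a = k *: y.
Proof.
move=> yy; have sq0 : Num.sqrt (- lorentz y y) != 0.
  by rewrite gt_eqF// sqrtr_gt0; lra.
have [y0|y0|y0] := ltgtP (y ord0 ord0) 0.
- have [||a] := @future_timelike_ray (-1 *: y).
  + by rewrite !lorentzE; lra.
  + by rewrite mxE; lra.
  rewrite !lorentzE !mulrA mulrNN !mul1r => aE.
  exists a, (- (Num.sqrt (- lorentz y y))^-1); split.
    by rewrite oppr_eq0 invr_eq0.
  by rewrite aE scalerA; congr (_ *: _); rewrite mulrN1.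
- have [//|a aE] := future_timelike_ray yy.
  by exists a, (Num.sqrt (- lorentz y y))^-1; rewrite aE invr_eq0.
- by move: yy; rewrite /lorentz y0; have := spatial_ge0 y; lra.
Qed.

Lemma spatial_eq0 x : spatial x x = 0 -> x ord0 ord0 = 0 -> x = 0.
Proof.
move=> /eqP; rewrite psumr_eq0; last by move=> i _; rewrite -expr2 sqr_ge0.
move=> /allP us u0; apply/rowP => i; rewrite mxE.
case: (unliftP ord0 i) => [j ->|->//].
by have := us j; rewrite mem_index_enum => /(_ isT)/=; rewrite mulf_eq0 orbb => /eqP.
Qed.

(** Counterpart of [orth_ge0] at infinity: on the orthogonal complement of an
    isotropic line the form is still semidefinite (it vanishes on the line
    itself), because [u0 * v0 = spatial u v] and Cauchy-Schwarz bound the time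
    coordinate of [u] by its spatial norm. *)
Lemma null_orth_ge0 u v : v != 0 -> lorentz v v = 0 -> lorentz u v = 0 ->
  0 <= lorentz u u.
Proof.
move=> v0 vv uv.
have sv : spatial v v = v ord0 ord0 ^+ 2 by move: vv; rewrite /lorentz; lra.
have suv : spatial u v = u ord0 ord0 * v ord0 ord0.
  by move: uv; rewrite /lorentz; lra.
have t0 : 0 < v ord0 ord0 ^+ 2.
  rewrite lt0r sqr_ge0 andbT sqrf_eq0; apply: contraNneq v0 => t0.
  by apply/eqP/spatial_eq0 => //; rewrite sv t0 expr0n.
have := spatial_CS u v; rewrite sv suv exprMn ler_pM2r// /lorentz.
by rewrite expr2; lra.
Qed.

Lemma null_orth_CS u w v : v != 0 -> lorentz v v = 0 ->
  lorentz u v = 0 -> lorentz w v = 0 ->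
  lorentz u w ^+ 2 <= lorentz u u * lorentz w w.
Proof.
move=> v0 vv uv wv; apply: discr_le => s t.
have : 0 <= lorentz (s *: u + t *: w) (s *: u + t *: w).
  by apply: (null_orth_ge0 v0 vv); rewrite !lorentzE uv wv; ring.
by rewrite !lorentzE (lorentzC w u); lra.
Qed.

End LorentzAlgebra.

(** * Hyperplanes and the distance between ultraparallel ones *)

Section Planes.
Context {R : realType} {d : nat}.
Implicit Types (n m : 'rV[R]_d.+1) (x y a b p q : hyp R d) (H J K : hyperplane R d).

Definition base_point : hyp R d.
Proof.
suff h : @hyperboloid R d (\row_(j < d.+1) (j == ord0)%:R) by exact: Hyp h.
apply/andP; rewrite !mxE eqxx; split => //.
rewrite /lorentz /spatial big1; last by move=> i _; rewrite !mxE /= mul0r.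
by rewrite !mxE eqxx addr0 mulr1.
Qed.

(** The component of a timelike vector orthogonal to a spacelike one is again
    timelike: removing a spacelike component lowers the form. *)
Lemma plane_nonempty H : plane H !=set0.
Proof.
have n0 := normal_spacelike H; set n := normal H in n0 *.
pose p := hval base_point; pose al := lorentz n p.
have pp : lorentz p p = -1 := hyp_self base_point.
have [|a [k [_ ak]]] := @timelike_line _ _ (lorentz n n *: p - al *: n).
  rewrite -scaleNr !lorentzE pp (lorentzC p n) -/al.
  by have := sqr_ge0 al; nra.
exists a; rewrite /plane/= ak -scaleNr !lorentzE -/n -/al; ring.
Qed.

(** The position of two hyperplanes is read off the Gram determinant of their
    normals. If it is negative, the normals span a plane of signature (1,1),
    and a common finite or infinite point would make the form semidefinite on
    that plane. If it is positive, the span is definite and its complement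
    contains timelike vectors; if it is zero, the span contains an isotropic
    vector orthogonal to both normals, or the two normals are proportional. *)
Lemma ultraparallelP H J : ultraparallel H J <->
  lorentz (normal H) (normal H) * lorentz (normal J) (normal J) <
  lorentz (normal H) (normal J) ^+ 2.
Proof.
have n0 := normal_spacelike H; have m0 := normal_spacelike J.
rewrite /ultraparallel /plane /plane_at_infinity.
set n := normal H in n0 *; set m := normal J in m0 *.
set N := lorentz n n in n0 *; set M := lorentz m m in m0 *.
split=> [[fin inf]|lt]; last first.
  split; rewrite -subset0.
    move=> x [nx mx]; have := orth_CS (hvalP x) nx mx.
    by rewrite leNgt lt.
  move=> v [[v0 vv nv] [_ _ mv]]; have := null_orth_CS v0 vv nv mv.
  by rewrite leNgt lt.
set g := lorentz n m; rewrite ltNge; apply/negP; rewrite le_eqVlt => /orP[/eqP|] le.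
  (* The component of m orthogonal to n, which is isotropic here; when it
     vanishes both hyperplanes are the same nonempty set. *)
  have [v0|v0] := eqVneq (N *: m - g *: n) 0.
    have [x nx] := plane_nonempty H.
    suff : (plane H `&` plane J) x by rewrite /plane fin.
    split=> //; rewrite /plane/=; apply: (mulfI (lt0r_neq0 n0)).
    have := congr1 (lorentz^~ (hval x)) v0; rewrite -scaleNr /= !lorentzE.
    move: nx; rewrite /plane/= -/n -/m => ->.
    by rewrite -(scale0r n) lorentzZl; lra.
  suff : (plane_at_infinity H `&` plane_at_infinity J) (N *: m - g *: n).
    by rewrite /plane_at_infinity inf.
  rewrite /plane_at_infinity /= -/n -/m -scaleNr !lorentzE (lorentzC m n).
  rewrite -/g -/N -/M; split; split => //; rewrite ?scaleNr//.
  - by transitivity (N * (N * M - g ^+ 2)); [ring|rewrite le; ring].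
  - by ring.
  - by transitivity (N * (N * M - g ^+ 2)); [ring|rewrite le; ring].
  - by transitivity (N * M - g ^+ 2); [ring|rewrite le; ring].
pose p := hval base_point; pose al := lorentz n p; pose be := lorentz m p.
pose D := N * M - g ^+ 2; have D0 : 0 < D by rewrite subr_gt0.
have pp : lorentz p p = -1 := hyp_self base_point.
have Q0 : 0 <= M * al ^+ 2 - 2 * g * al * be + N * be ^+ 2.
  suff : 0 <= N * (M * al ^+ 2 - 2 * g * al * be + N * be ^+ 2).
    by rewrite pmulr_rge0.
  have -> : N * (M * al ^+ 2 - 2 * g * al * be + N * be ^+ 2)
    = D * al ^+ 2 + (N * be - g * al) ^+ 2 by rewrite /D; ring.
  by apply: addr_ge0; rewrite ?sqr_ge0// mulr_ge0 ?sqr_ge0// ltW.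
(* D times the projection of p to the complement of the span of n and m. *)
have [|a [k [_ ak]]] :=
    @timelike_line _ _ (D *: p + (g * be - M * al) *: n + (g * al - N * be) *: m).
  rewrite !lorentzE pp (lorentzC p n) (lorentzC p m) (lorentzC m n).
  rewrite -/al -/be -/g -/N -/M.
  set E := (X in X < 0).
  have -> : E = - (D * (D + (M * al ^+ 2 - 2 * g * al * be + N * be ^+ 2))).
    by rewrite /E /D; ring.
  by rewrite oppr_lt0 mulr_gt0// ltr_wpDr.
suff : (plane H `&` plane J) a by rewrite /plane fin.
rewrite /plane/= -/n -/m ak !lorentzE (lorentzC m n) -/al -/be -/g -/N -/M.
by split; rewrite /D; ring.
Qed.

(** Cauchy-Schwarz used twice: once in the tangent space at [x], for the normal
    of [H] and the direction of [y], and once in the tangent space at [y], for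
    the normal of [J] and the projection of the normal of [H]. *)
Lemma planes_dist_lower H J x y : plane H x -> plane J y ->
  lorentz (normal H) (normal J) ^+ 2 <=
  lorentz (hval x) (hval y) ^+ 2 *
    (lorentz (normal H) (normal H) * lorentz (normal J) (normal J)).
Proof.
rewrite /plane /=; set n := normal H; set m := normal J => nx my.
set k := lorentz (hval x) (hval y).
have m0 : 0 <= lorentz m m := ltW (normal_spacelike J).
have [yx yy] := hyp_projE (hvalP y) (hvalP x).
have [xx yys] := (hyp_self x, hyp_self y).
have := orth_CS (hvalP x) nx yx.
rewrite yy lorentzDr lorentzZr nx mulr0 addr0 (lorentzC (hval y)) -/k => h1.
have ny : lorentz (n + lorentz n (hval y) *: hval y) (hval y) = 0.
  by rewrite !lorentzE yys; ring.
have := orth_CS (hvalP y) ny my.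
rewrite !lorentzE yys (lorentzC (hval y) m) my (lorentzC (hval y) n).
by move: (lorentz n m) (lorentz n n) (lorentz m m) m0 h1 => g N M M0 h1 h2; nra.
Qed.

(** The common perpendicular of the two hyperplanes lies in the plane spanned by
    their normals; its feet are the points of [H] and [J] in that plane, and
    there [planes_dist_lower] is an equality. *)
Lemma planes_feet H J : ultraparallel H J -> exists x y,
  [/\ plane H x, plane J y &
    lorentz (hval x) (hval y) ^+ 2 *
    (lorentz (normal H) (normal H) * lorentz (normal J) (normal J)) =
    lorentz (normal H) (normal J) ^+ 2].
Proof.
move=> /ultraparallelP.
have n0 := normal_spacelike H; have m0 := normal_spacelike J.
rewrite /plane; set n := normal H in n0 *; set m := normal J in m0 *.
set N := lorentz n n in n0 *; set M := lorentz m m in m0 *.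
set g := lorentz n m => lt.
have D0 : 0 < g ^+ 2 - N * M by rewrite subr_gt0.
have [|x [k [k0 xk]]] := @timelike_line _ _ (N *: m - g *: n).
  rewrite -scaleNr !lorentzE (lorentzC m n) -/g -/N -/M; nra.
have [|y [l [l0 yl]]] := @timelike_line _ _ (M *: n - g *: m).
  rewrite -scaleNr !lorentzE (lorentzC m n) -/g -/N -/M; nra.
exists x, y; have [xx yy] := (hyp_self x, hyp_self y).
rewrite /= xk yl -!scaleNr !lorentzE (lorentzC m n) -/g -/N -/M.
move: xx yy; rewrite xk yl -!scaleNr !lorentzE (lorentzC m n) -/g -/N -/M => xx yy.
have xx' : k ^+ 2 * N * (g ^+ 2 - N * M) = 1 by rewrite -[RHS]opprK -xx; ring.
have yy' : l ^+ 2 * M * (g ^+ 2 - N * M) = 1 by rewrite -[RHS]opprK -yy; ring.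
split; [by ring|by ring|].
set E := LHS.
have -> : E = g ^+ 2 * (k ^+ 2 * N * (g ^+ 2 - N * M)) *
    (l ^+ 2 * M * (g ^+ 2 - N * M)).
  by rewrite /E; ring.
by rewrite xx' yy' !mulr1.
Qed.

(** The hyperbolic cosine of the distance between ultraparallel hyperplanes, in
    a form independent of the scaling of the normals. *)
Definition planes_cosh H J : R :=
  `|lorentz (normal H) (normal J)| /
  Num.sqrt (lorentz (normal H) (normal H) * lorentz (normal J) (normal J)).

Lemma set_dist_planes H J : ultraparallel H J ->
  set_dist (plane H) (plane J) = arcosh (planes_cosh H J).
Proof.
move=> U; have [x [y [Hx Jy xy]]] := planes_feet U.
have NM0 := mulr_gt0 (normal_spacelike H) (normal_spacelike J).
have s0 : 0 < Num.sqrt (lorentz (normal H) (normal H) * lorentz (normal J) (normal J)).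
  by rewrite sqrtr_gt0.
have cxy : planes_cosh H J = - lorentz (hval x) (hval y).
  have k0 : 0 <= - lorentz (hval x) (hval y) by have := lorentz_le_N1 x y; lra.
  rewrite /planes_cosh -sqrtr_sqr -xy sqrtrM ?sqr_ge0// mulfK ?gt_eqF//.
  by rewrite sqrtr_sqr -normrN ger0_norm.
apply/eqP; rewrite eq_le; apply/andP; split.
  rewrite cxy; apply: ge_inf; last by exists x => //; exists y.
  by exists 0 => _ [? _ [? _ <-]]; exact: mdist_ge0.
apply: lb_le_inf; first by exists (mdist x y), x => //; exists y.
move=> _ [x' Hx' [y' Jy' <-]]; rewrite cxy; apply: arcosh_le.
  exact: hyp_ge1 (hvalP _) (hvalP _).
have := planes_dist_lower Hx' Jy'; rewrite -xy ler_pM2r//.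
have := lorentz_le_N1 x y; have := lorentz_le_N1 x' y'; nra.
Qed.

End Planes.

(** * Topology of the hyperboloid *)

Section Topology.
Context {R : realType} {d : nat}.
Implicit Types (x y u v n m : 'rV[R]_d.+1) (a b p q : hyp R d).

Lemma cvg_lorentz {T : Type} {F : set_system T} {FF : Filter F}
    (f g : T -> 'rV[R]_d.+1) u v :
  f @ F --> u -> g @ F --> v -> lorentz (f t) (g t) @[t --> F] --> lorentz u v.
Proof.
move=> fu gv.
have fi i : f t ord0 i @[t --> F] --> u ord0 i.
  exact: (cvg_comp f (fun M : 'rV[R]_d.+1 => M ord0 i) fu (@coord_continuous _ _ _ _ _ u)).
have gi i : g t ord0 i @[t --> F] --> v ord0 i.
  exact: (cvg_comp g (fun M : 'rV[R]_d.+1 => M ord0 i) gv (@coord_continuous _ _ _ _ _ v)).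
apply: cvgD; first by apply: cvgN; apply: cvgM.
by apply: cvg_big => [|i _]; [exact: add_continuous|apply: cvgM].
Qed.

Lemma continuous_lorentz (T : topologicalType) (f g : T -> 'rV[R]_d.+1) :
  continuous f -> continuous g -> continuous (fun t => lorentz (f t) (g t)).
Proof. by move=> cf cg t; apply: cvg_lorentz; [exact: cf|exact: cg]. Qed.

Lemma arcosh_cvg1 : arcosh t @[t --> (1 : R)] --> (0 : R).
Proof.
rewrite -(@arcosh1 R) /arcosh.
apply: (@continuous_cvg _ _ _ _ _ _ (@ln R)).
  by apply: continuous_ln; rewrite ltr_pwDl// sqrtr_ge0.
apply: cvgD; first exact: cvg_id.
apply: (@continuous_cvg _ _ _ _ _ _ (@Num.sqrt R)); first exact: sqrt_continuous.
by apply: cvgB; [exact: exprn_continuous|exact: cvg_cst].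
Qed.

(** The link between the metric topology of [hyp R d] and the topology of the
    ambient vector space: radial projection to the hyperboloid is continuous.
    Stating it for rays rather than for points of the hyperboloid lets a vector
    be perturbed linearly, without renormalising it by hand. *)
Lemma near_ray a (U : set (hyp R d)) : nbhs a U ->
  \forall y \near hval a, exists2 b, U b & exists2 k : R, 0 < k & hval b = k *: y.
Proof.
move=> /nbhs_ballP[e /= e0 eU].
pose F := nbhs (hval a).
have cyy : (fun y => lorentz y y) @ F --> (-1 : R).
  by rewrite -(hyp_self a); apply: cvg_lorentz; exact: cvg_id.
have cy0 : (fun y : 'rV[R]_d.+1 => y ord0 ord0) @ F --> hval a ord0 ord0.
  exact: coord_continuous.
have cNyy : (fun y => - lorentz y y) @ F --> (1 : R).
  by rewrite -(opprK (1 : R)); exact: cvgN.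
have ck : (fun y => (Num.sqrt (- lorentz y y))^-1) @ F --> (1 : R).
  rewrite -(invr1 R); apply: cvgV; first exact: oner_neq0.
  rewrite -(sqrtr1 R).
  by apply: (@continuous_cvg _ _ _ F _ _ (@Num.sqrt R)) => //; exact: sqrt_continuous.
have cg : (fun y => arcosh (- lorentz (hval a) ((Num.sqrt (- lorentz y y))^-1 *: y)))
    @ F --> (0 : R).
  rewrite -(@arcosh1 R); apply: (@continuous_cvg _ _ _ F _ _ (@arcosh R) 1).
    by rewrite /prop_for /continuous_at arcosh1; exact: arcosh_cvg1.
  rewrite -(opprK (1 : R)) -(hyp_self a); apply: cvgN.
  apply: cvg_lorentz; first exact: cvg_cst.
  by rewrite -(scale1r (hval a)); apply: cvgZ => //; exact: cvg_id.
near=> y.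
have yy : lorentz y y < 0.
  by near: y; apply: (cvgr_lt _ cyy); rewrite oppr_lt0.
have y0 : 0 < y ord0 ord0.
  by near: y; apply: (cvgr_gt _ cy0); have [] := hyperboloidP (hvalP a).
have [b bE] := future_timelike_ray yy y0.
exists b; last first.
  by eexists; last exact: bE; rewrite invr_gt0 sqrtr_gt0; lra.
apply: eU; rewrite ballEmdist /= /mdist /= /hdist bE.
by near: y; exact: (cvgr_lt _ cg).
Unshelve. all: by end_near. Qed.

Lemma rV_norm_le x (B : R) : 0 <= B ->
  x ord0 ord0 ^+ 2 + spatial x x <= B ^+ 2 -> `|x| <= B.
Proof.
move=> B0 xB; rewrite [leLHS]mx_normrE; apply/bigmax_leP; split=> // -[i j] _ /=.
rewrite (ord1 i); rewrite -(@ler_sqr _ `|_|) ?nnegrE// real_normK ?num_real//.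
apply: le_trans xB; case: (unliftP ord0 j) => [k ->|->].
  rewrite /spatial (bigD1 k)//= -expr2 addrCA ler_wpDr// addr_ge0 ?sqr_ge0//.
  by apply: sumr_ge0 => ? _; rewrite -expr2 sqr_ge0.
by rewrite ler_wpDr// spatial_ge0.
Qed.

(** A bound on the distance to a fixed point [b] bounds the time coordinate,
    and hence all coordinates: hyperbolic balls are bounded sets of vectors. *)
Lemma time_le a b (M : R) : - lorentz (hval a) (hval b) <= M ->
  hval a ord0 ord0 <= 2 * hval b ord0 ord0 * M.
Proof.
have [_ a0 sa] := hyperboloidP (hvalP a); have [_ b0 sb] := hyperboloidP (hvalP b).
have := spatial_CS (hval a) (hval b); have := lorentz_le_N1 a b.
have := spatial_ge0 (hval b); rewrite sa sb /lorentz.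
move: (spatial _ _) (hval a ord0 ord0) (hval b ord0 ord0) a0 b0 => s t r t0 r0 r1 s1 cs sM.
have [//|lt] := leP t (2 * r * M).
have M1 : 1 <= M by lra.
have p : 0 <= t * r - M by nra.
have q : (t * r - M) ^+ 2 <= (t ^+ 2 - 1) * (r ^+ 2 - 1).
  by apply: le_trans cs; rewrite ler_sqr ?nnegrE; lra.
nra.
Qed.

Lemma arcosh_le_exp (t r : R) : 1 <= t -> arcosh t <= r -> t <= expR r.
Proof.
move=> t1 tr; rewrite -[leLHS](@lnK _ t); last by rewrite posrE; lra.
rewrite ler_expR; apply: le_trans tr; rewrite /arcosh ler_ln ?posrE.
  by rewrite lerDl sqrtr_ge0.
  by lra.
by rewrite ltr_wpDr ?sqrtr_ge0//; lra.
Qed.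

Lemma bounded_by (A : set 'rV[R]_d.+1) (B : R) :
  (forall x, A x -> `|x| <= B) -> bounded_set A.
Proof.
move=> AB; exists B; split=> [|M BM x /AB xB]; first exact: num_real.
exact: le_trans xB (ltW BM).
Qed.

(** Working with the image in the ambient space gives access to the
    Heine-Borel property. Closedness transfers by [near_ray]. *)
Lemma compact_hval (C : set (hyp R d)) :
  closed C -> metric_bounded C -> compact (@hval R d @` C).
Proof.
move=> clC [r Cr].
have [[c Cc]|/set0P/negP/negPn/eqP ->] := pselect (C !=set0); last first.
  by rewrite image_set0; exact: compact0.
apply: bounded_closed_compact.
  pose T := 2 * hval c ord0 ord0 * expR r.
  apply: (@bounded_by _ (2 * T)) => _ [a Ca <-].
  have aT : hval a ord0 ord0 <= T.
    apply: time_le; apply: arcosh_le_exp; first exact: hyp_ge1 (hvalP _) (hvalP _).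
    exact: Cr.
  have [_ a0 sa] := hyperboloidP (hvalP a).
  by apply: rV_norm_le; rewrite ?sa; nra.
move=> y cly.
have clE : closed [set y : 'rV[R]_d.+1 | lorentz y y = -1].
  apply: (@preimage_closed _ _ (fun y : 'rV[R]_d.+1 => lorentz y y) [set -1]).
    by move=> z _; apply: (@cvg_lorentz _ (nbhs _) _ id id); exact: cvg_id.
  exact: closed_eq.
have yy : lorentz y y = -1.
  apply: clE => B /cly[z [[a _ <-] Bz]]; exists (hval a); split=> //.
  exact: hyp_self.
have clT : closed [set y : 'rV[R]_d.+1 | 0 <= y ord0 ord0].
  apply: (@preimage_closed _ _ (fun y : 'rV[R]_d.+1 => y ord0 ord0) [set z | 0 <= z]).
    by move=> z _; exact: coord_continuous.
  exact: closed_ge.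
have y0 : 0 <= y ord0 ord0.
  apply: clT => B /cly[z [[a _ <-] Bz]]; exists (hval a); split=> //=.
  by have [_ /ltW] := hyperboloidP (hvalP a).
have Hy : hyperboloid y.
  apply/andP; rewrite yy eqxx; split=> //.
  rewrite lt_neqAle y0 andbT eq_sym; apply/negP => /eqP y00.
  by move: yy; rewrite /lorentz y00; have := spatial_ge0 y; lra.
exists (Hyp Hy) => //; apply: clC => U.
move=> /near_ray /cly[_ [[a Ca <-]] [b Ub [k k0 bE]]].
exists a; split=> //; suff -> : a = b by [].
have := hyp_self b; rewrite bE !lorentzE hyp_self => k1.
have {k1}k1 : k = 1 by nra.
by apply: val_inj; rewrite /= bE k1 scale1r.
Qed.

End Topology.

(** * Supporting hyperplanes and their contact points *)

Section Supports.
Context {R : realType} {d : nat}.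
Implicit Types (u v n m : 'rV[R]_d.+1) (a b p q x y : hyp R d) (C : set (hyp R d))
  (H J K : hyperplane R d).

Lemma interior_ray C x v : C° x -> exists2 t : R, 0 < t &
  exists2 b, C b & exists2 k : R, 0 < k & hval b = k *: (hval x + t *: v).
Proof.
move=> /near_ray Cx.
have cv : (fun t : R => hval x + t *: v) @ (0 : R)^'+ --> hval x.
  apply: cvg_at_right_filter; rewrite -[X in _ --> X]addr0 -(scale0r v).
  by apply: cvgD; [exact: cvg_cst|apply: cvgZr_tmp; exact: cvg_id].
have [t [t0 tb]] := filter_ex (filterI (nbhs_right_gt (0 : R)) (cv _ Cx)).
by exists t.
Qed.

(** If [H] met the interior, pushing that point along the opposite of the normal
    would leave the half-space. *)
Lemma supports_halfspace C H p : C p -> plane H p ->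
  (forall x, C x -> 0 <= lorentz (normal H) (hval x)) -> supports H C.
Proof.
move=> Cp Hp HC; split; first by exists p.
rewrite -subset0 => x [Hx Cx].
have [t t0 [b Cb [k k0 bE]]] := interior_ray (- normal H) Cx.
have := HC _ Cb; move: Hx; rewrite /plane /= bE -scaleN1r !lorentzE => ->.
have := mulr_gt0 (mulr_gt0 k0 t0) (normal_spacelike H); lra.
Qed.

(** Meeting the interior is an open condition on the hyperplane, whence
    supporting hyperplanes form a closed set. A point of the hyperplane is
    carried to a nearby hyperplane by orthogonal projection. *)
Lemma near_meets C m x : 0 < lorentz m m -> C° x -> lorentz m (hval x) = 0 ->
  \forall m' \near m, exists2 b, C° b & lorentz m' (hval b) = 0.
Proof.
move=> m0 Cx mx.
pose F := nbhs m.
(* The orthogonal projection of x along m', scaled so as to need no inverse of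
   a varying quantity. *)
pose y m' := (lorentz m m)^-1 *:
  (lorentz m' m' *: hval x - lorentz m' (hval x) *: m').
have yx : y @ F --> hval x.
  have -> : hval x = y m by rewrite /y mx scale0r subr0 scalerA mulVf ?scale1r ?gt_eqF.
  apply: cvgZr; apply: cvgB; apply: cvgZ.
  - by apply: cvg_lorentz; exact: cvg_id.
  - exact: cvg_cst.
  - by apply: cvg_lorentz; [exact: cvg_id|exact: cvg_cst].
  - exact: cvg_id.
have yC := yx _ (near_ray (open_nbhs_nbhs (conj (open_interior C) Cx))).
apply: (@filterS _ F _ _ _ _ yC) => m' /= [b Cb [k k0 bE]]; exists b => //.
by rewrite bE /y -scaleNr !lorentzE; ring.
Qed.

(** Normalising the normal bounds it, and recording a contact point turns the
    existence of such a point into closed conditions; together they make this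
    parametrisation of the supporting hyperplanes compact. *)
Definition contacts C : set ('rV[R]_d.+1 * 'rV[R]_d.+1) :=
  [set z | [/\ lorentz z.1 z.1 = 1, (@hval R d @` C) z.2, lorentz z.1 z.2 = 0 &
    forall b, C° b -> lorentz z.1 (hval b) <> 0]].

Lemma closed_lorentz (T : topologicalType) (f g : T -> 'rV[R]_d.+1) (c : R) :
  continuous f -> continuous g -> closed [set t | lorentz (f t) (g t) = c].
Proof.
move=> cf cg; apply: (@preimage_closed _ _ _ [set c]); last exact: closed_eq.
by move=> t _; exact: continuous_lorentz.
Qed.

(** Normals are bounded because a unit vector orthogonal to a point of bounded
    time coordinate is bounded, by [orth_time_le]. *)
Lemma compact_contacts C : closed C -> metric_bounded C -> compact (contacts C).
Proof.
move=> clC bC; have cK := compact_hval clC bC.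
have [C0|C0] := pselect (C !=set0); last first.
  rewrite (_ : contacts C = set0); first exact: compact0.
  by rewrite -subset0 => z [_ [a Ca _] _ _]; apply: C0; exists a.
have [_ /set_mem[c Cc <-] cmax] : exists2 c, c \in (@hval R d @` C) &
    forall t : 'rV[R]_d.+1, t \in (@hval R d @` C) -> t ord0 ord0 <= c ord0 ord0.
  apply: (@compact_EVT_max _ R (fun x : 'rV[R]_d.+1 => x ord0 ord0)) => //.
    by case: C0 => a Ca; exists (hval a), a.
  by apply: continuous_subspaceT; exact: coord_continuous.
pose B : R := 2 * hval c ord0 ord0.
have cB : compact [set m : 'rV[R]_d.+1 | `|m| <= B].
  apply: bounded_closed_compact; first exact: (@bounded_by _ _ _ B).
  apply: (@preimage_closed _ _ (fun m : 'rV[R]_d.+1 => `|m|) [set z | z <= B]).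
    by move=> m _; exact: norm_continuous.
  exact: closed_le.
apply: (subclosed_compact _ (compact_setX cB cK)); last first.
  move=> [m w] [/= mm [p Cp /= pw] mp _]; split=> /=; last by exists p.
  rewrite -pw in mp.
  have [_ p0 _] := hyperboloidP (hvalP p).
  have := cmax (hval p); rewrite inE => /(_ (ex_intro2 _ _ _ Cp erefl)) pc.
  have := orth_time_le (hvalP p) mp.
  have sm : spatial m m = 1 + m ord0 ord0 ^+ 2.
    by move: mm; rewrite /lorentz /=; lra.
  rewrite sm => h; apply: rV_norm_le; first by rewrite /B; lra.
  by rewrite sm /B; nra.
move=> z clz.
have z11 : lorentz z.1 z.1 = 1.
  have cl : closed [set z : 'rV[R]_d.+1 * 'rV[R]_d.+1 | lorentz z.1 z.1 = 1].
    by apply: closed_lorentz => ?; exact: cvg_fst.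
  by apply: cl => U /clz[w [[ww _ _ _] Uw]]; exists w.
split=> //.
- have cl := compact_closed (@norm_hausdorff _ _) cK.
  apply: cl => U Uz; have : nbhs z (snd @^-1` U) by exact: cvg_snd.
  by move=> /clz[w [[_ ww _ _] Uw]]; exists w.2.
- have cl : closed [set z : 'rV[R]_d.+1 * 'rV[R]_d.+1 | lorentz z.1 z.2 = 0].
    by apply: closed_lorentz => ?; [exact: cvg_fst|exact: cvg_snd].
  by apply: cl => U /clz[w [[_ _ ww _] Uw]]; exists w.
- move=> b Cb zb.
  have z0 : 0 < lorentz z.1 z.1 by rewrite z11.
  have : nbhs z (fst @^-1` [set m | exists2 b, C° b & lorentz m (hval b) = 0]).
    by apply: cvg_fst; exact: (near_meets z0 Cb zb).
  by move=> /clz[w [[_ _ _ nw] [b' Cb' /nw]]]; apply.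
Qed.

Lemma contacts_supports C H p : contacts C (normal H, hval p) -> supports H C.
Proof.
move=> [_ [q Cq /= qp] Hp nC]; split.
  by exists p; split=> //; rewrite -(_ : q = p)//; exact: val_inj.
by rewrite -subset0 => x [Hx /nC].
Qed.

Lemma supports_contacts C H : supports H C -> exists p,
  contacts C ((Num.sqrt (lorentz (normal H) (normal H)))^-1 *: normal H, hval p).
Proof.
have n0 := normal_spacelike H.
move=> [[p [Hp Cp]] HC]; exists p; split=> /=.
- rewrite !lorentzE mulrA -invfM -expr2 sqr_sqrtr ?ltW// mulVf// gt_eqF//.
- by exists p.
- by rewrite lorentzZl Hp mulr0.
- move=> b Cb; rewrite lorentzZl => /eqP; rewrite mulf_eq0 invr_eq0 sqrtr_eq0.
  rewrite leNgt n0 /= => /eqP Hb; suff : (plane H `&` C°) b by rewrite HC.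
  by split.
Qed.

End Supports.

(** * Existence of a farthest supporting hyperplane *)

Section WidthExists.
Context {R : realType} {d : nat}.
Implicit Types (u v n m : 'rV[R]_d.+1) (a b p q x y : hyp R d) (C : set (hyp R d))
  (H J K : hyperplane R d).

Lemma planes_cosh_sqr H J : planes_cosh H J ^+ 2 =
  lorentz (normal H) (normal J) ^+ 2 /
  (lorentz (normal H) (normal H) * lorentz (normal J) (normal J)).
Proof.
rewrite /planes_cosh expr_div_n real_normK ?num_real// sqr_sqrtr// ltW//.
by rewrite mulr_gt0 ?normal_spacelike.
Qed.

Lemma planes_cosh_ge0 H J : 0 <= planes_cosh H J.
Proof. by rewrite divr_ge0 ?sqrtr_ge0. Qed.

Lemma set_dist_planes_le H J K : ultraparallel H J -> ultraparallel H K ->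
  planes_cosh H K ^+ 2 <= planes_cosh H J ^+ 2 ->
  set_dist (plane H) (plane K) <= set_dist (plane H) (plane J).
Proof.
move=> HJ HK; rewrite ler_sqr ?nnegrE ?planes_cosh_ge0// => le.
rewrite !set_dist_planes//; apply: arcosh_le => //.
rewrite -(@ler_sqr _ 1) ?nnegrE ?planes_cosh_ge0// planes_cosh_sqr expr1n.
rewrite ler_pdivlMr ?mulr_gt0 ?normal_spacelike// mul1r.
exact/ltW/ultraparallelP.
Qed.

(** Let [q] be a point of [C] farthest from [H]. The hyperplane through [q]
    perpendicular to the perpendicular dropped from [q] to [H] lies beyond the
    equidistant surface of [H] through [q], so it has [C] on one side, and it is
    ultraparallel to [H]. *)
Lemma opposite_support C H : closed C -> metric_bounded C -> supports H C ->
  C° !=set0 -> exists2 K, ultraparallel H K & supports K C.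
Proof.
move=> clC bC [_ HC] [c Cc]; set n := normal H.
have n0 : 0 < lorentz n n := normal_spacelike H.
have [_ /set_mem[q Cq <-] qmax] : exists2 z, z \in (@hval R d @` C) &
    forall t : 'rV[R]_d.+1, t \in (@hval R d @` C) ->
      lorentz n t ^+ 2 <= lorentz n z ^+ 2.
  apply: (@compact_EVT_max _ R (fun x : 'rV[R]_d.+1 => lorentz n x ^+ 2)).
  - by exists (hval c), c => //; exact: interior_subset.
  - exact: compact_hval.
  - apply: continuous_subspaceT => x.
    apply: (@continuous_comp _ _ _ (lorentz n) (fun r => r ^+ 2)).
      by apply: (continuous_lorentz (f := cst n)); [exact: cst_continuous|move=> ?; exact: cvg_id].
    exact: exprn_continuous.
set s := lorentz n (hval q) in qmax *.
have {}qmax x : C x -> lorentz n (hval x) ^+ 2 <= s ^+ 2.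
  by move=> Cx; apply: qmax; rewrite inE; exists x.
have s0 : 0 < s ^+ 2.
  rewrite (lt_le_trans _ (qmax c (interior_subset Cc)))//.
  rewrite lt0r sqr_ge0 andbT sqrf_eq0; apply/negP => /eqP Hc.
  by suff : (plane H `&` C°) c by rewrite HC.
have qq := hyp_self q.
(* The projection of n to the tangent space at q is n + s q; the factor -s turns
   it towards C whichever side of H contains q. *)
pose w := (- s) *: n + (- s ^+ 2) *: hval q.
have ww : lorentz w w = s ^+ 2 * (lorentz n n + s ^+ 2).
  by rewrite /w !lorentzE (lorentzC (hval q) n) qq -/s; ring.
have w0 : 0 < lorentz w w by rewrite ww; apply: mulr_gt0 => //; exact: addr_gt0.
have nw : lorentz n w = - s * (lorentz n n + s ^+ 2).
  by rewrite /w !lorentzE -/s; ring.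
exists (Hyperplane w0).
  apply/ultraparallelP => /=; rewrite -/n ww nw; nra.
apply: (supports_halfspace Cq).
  by rewrite /plane /= /w !lorentzE qq -/s; ring.
move=> x Cx /=; rewrite /w !lorentzE.
have := lorentz_le_N1 q x; have := qmax _ Cx.
move: (lorentz n (hval x)) (lorentz (hval q) (hval x)) => t k ts k1.
have ts' : s * t <= s ^+ 2 by nra.
nra.
Qed.

(** On unit normals [m], the distance to [H] is an increasing function of
    [lorentz n m ^+ 2], which attains its maximum over the contacts. The
    maximiser is ultraparallel to [H] because some supporting hyperplane is
    ([opposite_support]). *)
Lemma width_exists C H : closed C -> metric_bounded C -> C° !=set0 ->
  supports H C -> exists w : R, is_width H C w.
Proof.
move=> clC bC C0 HC; have [W HW WC] := opposite_support clC bC HC C0.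
set n := normal H; have n0 : 0 < lorentz n n := normal_spacelike H.
have [p Wp] := supports_contacts WC.
have [z /set_mem Cz zmax] : exists2 z, z \in contacts C &
    forall t, t \in contacts C -> lorentz n t.1 ^+ 2 <= lorentz n z.1 ^+ 2.
  apply: (@compact_EVT_max _ R (fun t : 'rV[R]_d.+1 * 'rV[R]_d.+1 => lorentz n t.1 ^+ 2)).
  - by eexists; exact: Wp.
  - exact: compact_contacts.
  - apply: continuous_subspaceT => t.
    apply: (@continuous_comp _ _ _ (lorentz n \o fst) (fun r => r ^+ 2)).
      by apply: (continuous_lorentz (f := cst n)); [exact: cst_continuous|move=> ?; exact: cvg_fst].
    exact: exprn_continuous.
have [z1 [q Cq qz] _ _] := Cz.
have z0 : 0 < lorentz z.1 z.1 by rewrite z1.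
pose J := Hyperplane z0.
have JC : supports J C.
  by apply: (@contacts_supports _ _ _ _ q); rewrite /= qz -surjective_pairing.
have Kle K : supports K C ->
    lorentz n (normal K) ^+ 2 / lorentz (normal K) (normal K) <= lorentz n z.1 ^+ 2.
  move=> KC; have [r Kr] := supports_contacts KC.
  have := zmax _ (mem_set Kr); rewrite /= lorentzZr exprMn exprVn sqr_sqrtr.
    by rewrite mulrC.
  exact/ltW/normal_spacelike.
have HJ : ultraparallel H J.
  apply/ultraparallelP; rewrite /= z1 mulr1; apply: lt_le_trans (Kle _ WC).
  by rewrite ltr_pdivlMr ?normal_spacelike//; exact/ultraparallelP.
exists (set_dist (plane H) (plane J)), J => //; split=> // K HK KC.
apply: set_dist_planes_le => //; rewrite !planes_cosh_sqr /= z1 mulr1 -/n.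
rewrite invfM mulrCA -mulrC ler_pM2r ?invr_gt0//.
exact: Kle.
Qed.

End WidthExists.

(** * Comparison with the diameter *)

Section Diameter.
Context {R : realType} {d : nat}.
Implicit Types (a b p q x y : hyp R d) (C : set (hyp R d)) (H J K : hyperplane R d).

Lemma mdist_le_diam C a b : metric_bounded C -> C a -> C b -> mdist a b <= diam C.
Proof.
move=> [r Cr] Ca Cb; apply: ub_le_sup; last by exists a => //; exists b.
by exists r => _ [x Cx [y Cy <-]]; exact: Cr.
Qed.

(** A distance between points of contact bounds the distance of the planes. *)
Lemma set_dist_supports_le C H J : metric_bounded C ->
  supports H C -> supports J C -> set_dist (plane H) (plane J) <= diam C.
Proof.
move=> bC [[p [Hp Cp]] _] [[q [Jq Cq]] _].
apply: le_trans (mdist_le_diam bC Cp Cq); apply: ge_inf.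
  by exists 0 => _ [x _ [y _ <-]]; exact: mdist_ge0.
by exists p => //; exists q.
Qed.

(** The one place where the dimension has to be positive: for [d = 0] the space
    is a single point and has no diametral segment. *)
Lemma interior_two_points C : (0 < d)%N -> C° !=set0 ->
  exists a b, [/\ C a, C b & 1 < - lorentz (hval a) (hval b)].
Proof.
case: d C => // d' C _ [x Cx].
have [t t0 [b Cb [k k0 bE]]] := interior_ray (delta_mx ord0 (lift ord0 ord0)) Cx.
exists x, b; split=> //; first exact: interior_subset.
rewrite lt_neqAle eq_sym hyp_ge1 ?hvalP// andbT; apply/negP => /eqP.
move=> /(hyp_eq (hvalP x) (hvalP b)) xb.
have e0 := congr1 (fun u : 'rV_d'.+2 => u ord0 ord0) bE.
have e1 := congr1 (fun u : 'rV_d'.+2 => u ord0 (lift ord0 ord0)) bE.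
have [_ x0 _] := hyperboloidP (hvalP x).
move: e0 e1; rewrite -xb !mxE /= mulr0 addr0 mulr1 => e0.
have -> : k = 1 by nra.
by move=> e1; lra.
Qed.

Lemma diametral_pair C : compact (@hval R d @` C) -> C !=set0 ->
  exists a b, [/\ C a, C b &
    forall x y, C x -> C y -> - lorentz (hval x) (hval y) <= - lorentz (hval a) (hval b)].
Proof.
move=> cK [c Cc].
pose K2 := (@hval R d @` C) `*` (@hval R d @` C).
have [z /set_mem[[a Ca az] [b Cb bz]] zmax] : exists2 z, z \in K2 &
    forall t, t \in K2 -> - lorentz t.1 t.2 <= - lorentz z.1 z.2.
  apply: (@compact_EVT_max _ R (fun t : 'rV[R]_d.+1 * 'rV[R]_d.+1 => - lorentz t.1 t.2)).
  - by exists (hval c, hval c); split; exists c.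
  - exact: compact_setX.
  - apply: continuous_subspaceT => x; apply: cvgN.
    by apply: continuous_lorentz => y; [exact: cvg_fst|exact: cvg_snd].
exists a, b; split=> // x y Cx Cy; rewrite az bz.
by apply: (zmax (hval x, hval y)); rewrite inE; split; [exists x|exists y].
Qed.

(** The hyperplane through [a] perpendicular to the segment from [a] to [b]; its
    normal is the projection of [b] to the tangent space at [a]. *)
Lemma perp_plane a b : 1 < - lorentz (hval a) (hval b) -> exists H,
  normal H = hval b + lorentz (hval b) (hval a) *: hval a.
Proof.
move=> ab; have [_ nn] := hyp_projE (hvalP b) (hvalP a).
have n0 : 0 < lorentz (hval b + lorentz (hval b) (hval a) *: hval a)
    (hval b + lorentz (hval b) (hval a) *: hval a).
  by rewrite nn lorentzC; nra.
by exists (Hyperplane n0).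
Qed.

(** [C] lies in the ball around [b] through [a], which is on one side of its
    tangent hyperplane at [a]. *)
Lemma perp_plane_supports C a b H : C a ->
  normal H = hval b + lorentz (hval b) (hval a) *: hval a ->
  (forall x, C x -> - lorentz (hval b) (hval x) <= - lorentz (hval b) (hval a)) ->
  supports H C.
Proof.
move=> Ca nH far; apply: (supports_halfspace Ca).
  by rewrite /plane /= nH; have [] := hyp_projE (hvalP b) (hvalP a).
move=> x /far; rewrite nH !lorentzE.
by have := lorentz_le_N1 a x; have := lorentz_le_N1 b a; nra.
Qed.

(** The segment from [a] to [b] is the common perpendicular of the hyperplanes
    orthogonal to it at its two ends. *)
Lemma perp_planes a b H J : 1 < - lorentz (hval a) (hval b) ->
  normal H = hval b + lorentz (hval b) (hval a) *: hval a ->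
  normal J = hval a + lorentz (hval a) (hval b) *: hval b ->
  ultraparallel H J /\ set_dist (plane H) (plane J) = mdist a b.
Proof.
move=> ab nH nJ; set c := lorentz (hval a) (hval b) in ab nJ.
have c2 : 0 < c ^+ 2 - 1 by nra.
have HH : lorentz (normal H) (normal H) = c ^+ 2 - 1.
  by rewrite nH; have [_ ->] := hyp_projE (hvalP b) (hvalP a); rewrite lorentzC.
have JJ : lorentz (normal J) (normal J) = c ^+ 2 - 1.
  by rewrite nJ; have [_ ->] := hyp_projE (hvalP a) (hvalP b).
have HJ : lorentz (normal H) (normal J) = c * (c ^+ 2 - 1).
  rewrite nH nJ !lorentzE (lorentzC (hval b) (hval a)) !hyp_self -/c; ring.
have U : ultraparallel H J.
  apply/ultraparallelP; rewrite HH JJ HJ -subr_gt0.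
  have -> : (c * (c ^+ 2 - 1)) ^+ 2 - (c ^+ 2 - 1) * (c ^+ 2 - 1) =
    (c ^+ 2 - 1) ^+ 3 by ring.
  exact: exprn_gt0.
split=> //; rewrite set_dist_planes// /mdist /= /hdist -/c; congr arcosh.
apply/eqP; rewrite -(@eqrXn2 _ 2) ?planes_cosh_ge0//; last by lra.
rewrite planes_cosh_sqr HH JJ HJ; apply/eqP; field.
by rewrite gt_eqF.
Qed.

End Diameter.

Unset Implicit Arguments.

Theorem theorem1 (R : realType) (d : nat) (d_gt0 : (0 < d)%N)
    (C : set (hyp R d)) (C_body : convex_body C) :
  (forall H : hyperplane R d, supports H C -> exists w : R, is_width H C w) /\
  (let widths :=
     [set w : R | exists2 H : hyperplane R d, supports H C & is_width H C w] in
   widths (diam C) /\ ubound widths (diam C)).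
Proof.
have [clC bC _ C0] := C_body.
split; first by move=> H; exact: width_exists.
split; last first.
  move=> _ [H HC [J [_ JC _] ->]]; exact: set_dist_supports_le.
have [c Cc] := C0.
have [|a [b [Ca Cb abmax]]] := diametral_pair (compact_hval clC bC).
  by exists c; exact: interior_subset.
have ab : 1 < - lorentz (hval a) (hval b).
  have [x [y [Cx Cy xy]]] := interior_two_points d_gt0 C0.
  exact: lt_le_trans xy (abmax _ _ Cx Cy).
have diamE : diam C = mdist a b.
  apply/eqP; rewrite eq_le mdist_le_diam// andbT; apply: ge_sup.
    by exists (mdist a b), a => //; exists b.
  move=> _ [x Cx [y Cy <-]]; apply: arcosh_le; last exact: abmax.
  exact: hyp_ge1 (hvalP _) (hvalP _).
have [H nH] := perp_plane ab.
have [|J nJ] := @perp_plane _ _ b a; first by rewrite lorentzC.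
have [HJ dHJ] := perp_planes ab nH nJ.
have HC : supports H C.
  by apply: (perp_plane_supports Ca nH) => x Cx; rewrite (lorentzC _ (hval a)); exact: abmax.
have JC : supports J C.
  by apply: (perp_plane_supports Cb nJ) => x Cx; exact: abmax.
exists H => //; exists J; last by rewrite dHJ.
by split=> // K _ KC; rewrite dHJ -diamE; exact: set_dist_supports_le.
Qed.
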